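(* For every fixed integer $r\ge 1$ there is a constant $C_r>0$ such that the following holds for every integer $n\ge 1$: if $A\subset 2^{[n]}$ is both an antichain and a distance-$(2r+1)$ code, then \[|A|\le C_r\, 2^n n^{-r-1/2}.\]
   Context: $[n]=\{1,\dots,n\}$ and $2^{[n]}$ is the family of all subsets of $[n]$. A family $A\subset 2^{[n]}$ is an antichain if $x\not\subset y$ for all distinct $x,y\in A$. A family $A\subset 2^{[n]}$ is a distance-$d$ code if $|x\,\triangle\, y|\ge d$ for all distinct $x,y\in A$, where $\triangle$ denotes symmetric difference. *)

(* Defs.v *)
From mathcomp Require Import all_boot.
From Stdlib Require Import Reals.
Set Implicit Arguments. Unset Strict Implicit. Unset Printing Implicit Defensive.

Definition antichain (n : nat) (A : {set {set 'I_n}}) : Prop :=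
  forall x y, x \in A -> y \in A -> x != y -> ~~ (x \subset y).

Definition symdiff (n : nat) (x y : {set 'I_n}) : {set 'I_n} :=
  (x :\: y) :|: (y :\: x).

Definition distance_code (n d : nat) (A : {set {set 'I_n}}) : Prop :=
  forall x y, x \in A -> y \in A -> x != y -> (d <= #|symdiff x y|)%N.

(* Main.v *)
(* Let U be the up-closure and L the down-closure of A. For x in A and r-sets
   V in x, W off x, the set x - V + W is at distance 2r from x, so it cannot lie
   in both U and L. Hence for each x at least half of the pairs (V, W) leave U,
   or at least half leave L; by complementation consider U. As A is a code, the
   sets y = x + W are distinct for distinct (x, W), and y is in U while y - V is
   not. The number of such pairs (y, V) is controlled by the differences of the
   densities of U in layers i + r and i, and these telescope to at most r. This
   gains a factor of order n^r over the LYM inequality. *)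

Require Import Defs.
From mathcomp Require Import all_boot.
From Stdlib Require Import Reals.
From mathcomp Require Import all_boot all_order all_algebra zify lra.

Set Implicit Arguments. Unset Strict Implicit. Unset Printing Implicit Defensive.

(** * Binomial estimates over the natural numbers *)

Section Binomials.
Local Open Scope nat_scope.

Lemma mul_bin_add n a b :
  'C(n, a + b) * 'C(a + b, a) = 'C(n, a) * 'C(n - a, b).
Proof.
have [ltn|len] := ltnP n (a + b).
  rewrite bin_small // mul0n; have [ltna|lean] := ltnP n a.
    by rewrite bin_small.
  by rewrite (bin_small (n := n - a)) ?muln0 //; lia.
have h1 := bin_fact len; have h2 := bin_fact (leq_addr b a).
have h3 : 'C(n, a) * (a`! * (n - a)`!) = n`! by apply: bin_fact; lia.
have h4 : 'C(n - a, b) * (b`! * (n - a - b)`!) = (n - a)`! by apply: bin_fact; lia.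
have pos : 0 < a`! * b`! * (n - (a + b))`! by rewrite !muln_gt0 !fact_gt0.
apply/eqP; rewrite -(eqn_pmul2r pos); apply/eqP.
rewrite addKn in h2; rewrite subnDA in h1 *.
transitivity n`!; first by rewrite -h1 -h2; nia.
by rewrite -h3 -h4; nia.
Qed.

Lemma leq_bin_succ n k : k.*2 < n -> 'C(n, k) <= 'C(n, k.+1).
Proof.
move=> h; rewrite -(leq_pmul2l (ltn0Sn k)) mul_bin_left leq_mul2r.
by apply/orP; right; lia.
Qed.

Lemma leq_bin_central m k : 'C(m.*2, k) <= 'C(m.*2, m).
Proof.
have low j : 'C(m.*2, m - j) <= 'C(m.*2, m).
  elim: j => [|j IH]; first by rewrite subn0.
  have [ltj|gej] := ltnP j m; last by rewrite (_ : m - j.+1 = m - j) //; lia.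
  apply: leq_trans IH; rewrite (_ : m - j = (m - j.+1).+1); last by lia.
  by apply: leq_bin_succ; lia.
have [lekm|ltmk] := leqP k m; first by rewrite -(subKn lekm).
have [lek|gtk] := leqP k m.*2; last by rewrite bin_small.
by rewrite -(bin_sub lek) (_ : m.*2 - k = m - (k - m)) //; lia.
Qed.

(** Induction via [(m+1) C(2m+2, m+1) = 2 (2m+1) C(2m, m)]; the step comes down to
    [(2m+1)(2m+3) <= 4 (m+1)^2]. *)
Lemma central_bin_sqr m : 'C(m.*2, m) ^ 2 * m.*2.+1 <= 4 ^ m.*2.
Proof.
elim: m => [//|m IH].
have step : m.+1 * 'C(m.+1.*2, m.+1) = 2 * m.*2.+1 * 'C(m.*2, m).
  have h1 := mul_bin_diag m.*2.+2 m.
  have h2 := mul_bin_down m.*2.+1 m.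
  rewrite /= in h1 h2.
  rewrite (_ : m.*2.+1 - m = m.+1) in h2; last by lia.
  rewrite doubleS; nia.
rewrite -(leq_pmul2l (_ : 0 < m.+1 ^ 2)) ?expn_gt0 //.
rewrite mulnA -expnMn step.
have -> : 4 ^ m.+1.*2 = 16 * 4 ^ m.*2 by rewrite doubleS !expnS mulnA.
rewrite doubleS.
set c := 'C(_, _) in IH *; set d := 4 ^ _ in IH *.
apply: (@leq_trans (4 * m.*2.+1 * m.*2.+3 * (c ^ 2 * m.*2.+1))).
  by rewrite -!mulnn; nia.
apply: leq_trans (leq_mul (leqnn _) IH) _.
by rewrite -!mulnn; nia.
Qed.

(** In an even row the central coefficient dominates. An odd row costs a factor 2 by Pascal's rule,
    and its square is absorbed by the extra 4 in [4 ^ n]. *)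
Lemma bin_sqr_bound n k : 'C(n, k) ^ 2 * n <= 4 ^ n.
Proof.
rewrite -(odd_double_half n); set m := n./2.
case: (odd n); rewrite /= ?add1n ?add0n; last first.
  apply: leq_trans (central_bin_sqr m).
  by apply: leq_mul => //; rewrite leq_exp2r // leq_bin_central.
have h : 'C(m.*2.+1, k) <= 2 * 'C(m.*2, m).
  case: k => [|k]; first by rewrite bin0 muln_gt0 bin_gt0 -addnn leq_addr.
  by rewrite binS mul2n -['C(_, m).*2]addnn leq_add ?leq_bin_central.
rewrite (expnS 4); apply: leq_trans (leq_mul (leqnn 4) (central_bin_sqr m)).
by rewrite mulnA leq_mul2r /= -(expnMn 2 _ 2) leq_exp2r.
Qed.

(** The integer [s] stands in for the square root of [n], which keeps real numbers out of the
    counting. *)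
Lemma bin_sqrt_bound s n k : s ^ 2 <= n -> 'C(n, k) * s <= 2 ^ n.
Proof.
move=> hs; rewrite -(leq_exp2r _ _ (ltn0Sn 1)) expnMn -expnM (mulnC n) expnM.
by apply: leq_trans (bin_sqr_bound n k); rewrite leq_mul2l hs orbT.
Qed.

Lemma leq_expn_ffact n m : n ^ m <= (n + m) ^_ m.
Proof.
elim: m => [//|m IH]; rewrite addnS ffactSS expnS.
by apply: leq_mul => //; lia.
Qed.

Lemma leq_ffact_expn n m : n ^_ m <= n ^ m.
Proof.
elim: m => [//|m IH]; rewrite ffactnSr expnSr.
by apply: leq_mul => //; lia.
Qed.

Lemma leq_expn_bin n m : n ^ m <= 'C(n + m, m) * m`!.
Proof. by rewrite bin_ffact leq_expn_ffact. Qed.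

Lemma leq_expn_fact_exp2 n m : n ^ m.+1 <= m.+1`! * 2 ^ (n + m.+1).
Proof.
apply: leq_trans (leq_expn_bin _ _) _; rewrite mulnC leq_mul2l; apply/orP; right.
by have := @bin_sqrt_bound 1 (n + m.+1) m.+1; rewrite muln1; apply; lia.
Qed.

(** In terms of falling factorials: each factor on the left is at most [i + r <= 2r (i - r + 1)],
    and [i - r + 1] is the least factor of [i ^_ r]. *)
Lemma leq_bin_shift r i : 0 < r -> r <= i ->
  'C(i + r, r) <= (2 * r) ^ r * 'C(i, r).
Proof.
move=> r0 ri; rewrite -(leq_pmul2r (fact_gt0 r)) -mulnA !bin_ffact.
apply: leq_trans (leq_ffact_expn _ _) _.
apply: (@leq_trans ((2 * r) ^ r * (i - r).+1 ^ r)).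
  rewrite -expnMn leq_exp2r //; nia.
rewrite leq_mul2l; apply/orP; right.
have [j ->] : exists j, i = j + r by exists (i - r); lia.
rewrite addnK; elim: {r0 ri} r => [//|r IH].
by rewrite addnS ffactSS expnS; apply: leq_mul => //; lia.
Qed.

(** The source of the gain [n ^ r * s]: in [C(n, i) C(n+r, r) = C(n+r, r+i) C(i+r, r)] the factor
    [C(n+r, r)] supplies [n ^ r], and the square-root bound on [C(n+r, r+i)] supplies [s]. *)
Lemma bin_ratio_bound r n i s : 0 < r -> r <= i -> s ^ 2 <= n ->
  'C(n, i) * (n ^ r * s) <= (r`! * (2 * r) ^ r * 2 ^ (n + r)) * 'C(i, r).
Proof.
move=> r0 ri hs.
have e : 'C(n + r, r + i) * 'C(i + r, r) = 'C(n + r, r) * 'C(n, i).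
  by have := mul_bin_add (n + r) r i; rewrite addnK (addnC i r).
have h1 := leq_expn_bin n r.
have h2 : 'C(n + r, r + i) * s <= 2 ^ (n + r) by apply: bin_sqrt_bound; lia.
have h3 := leq_bin_shift r0 ri.
apply: (@leq_trans ('C(n, i) * ('C(n + r, r) * r`! * s))).
  by rewrite leq_mul2l leq_mul2r h1 !orbT.
have -> : 'C(n, i) * ('C(n + r, r) * r`! * s)
    = r`! * ('C(n + r, r + i) * s * 'C(i + r, r)).
  transitivity ('C(n + r, r) * 'C(n, i) * (r`! * s)); first by lia.
  by rewrite -e; lia.
rewrite -!mulnA leq_mul2l (mulnCA ((2 * r) ^ r)) mulnA; apply/orP; right.
by rewrite leq_mul.
Qed.

End Binomials.

(** * Up-closures, and the swaps that leave them *)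

Section SwapCounting.
Variable n : nat.
Implicit Types (x y z U V W : {set 'I_n}) (A : {set {set 'I_n}}).
Local Open Scope nat_scope.

Definition upset A : {set {set 'I_n}} :=
  [set y : {set 'I_n} | [exists x in A, x \subset y]].

Definition draws r x : {set {set 'I_n}} := [set V : {set 'I_n} | V \subset x & #|V| == r].

Definition exits r A x : {set {set 'I_n} * {set 'I_n}} :=
  [set p in setX (draws r x) (draws r (~: x)) | (x :\: p.1) :|: p.2 \notin upset A].

Lemma in_exits r A x V W : ((V, W) \in exits r A x) =
  [&& V \subset x, #|V| == r, W \subset ~: x, #|W| == r
    & (x :\: V) :|: W \notin upset A].
Proof. by rewrite in_set in_setX !in_set -!andbA. Qed.

Lemma mem_upset A x y : x \in A -> x \subset y -> y \in upset A.
Proof. by move=> xA xy; rewrite inE; apply/existsP; exists x; rewrite xA. Qed.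

Lemma upset_superset A y z : y \in upset A -> y \subset z -> z \in upset A.
Proof.
rewrite inE => /existsP[x /andP[xA xy]] yz.
exact: mem_upset xA (subset_trans xy yz).
Qed.

(** Seen through complementation, the up-closure of the complements is the down-closure of [A], so
    one notion of closure serves both directions. *)
Lemma upset_setC A z :
  (z \in upset [set ~: x | x in A]) -> exists2 x, x \in A & ~: z \subset x.
Proof.
rewrite inE => /existsP[y /andP[/imsetP[x xA ->]]].
by rewrite -setCS setCK => zx; exists x.
Qed.

Lemma symdiff_setC x y : symdiff (~: x) (~: y) = symdiff x y.
Proof. by apply/setP => i; rewrite !inE; case: (i \in x); case: (i \in y). Qed.

Lemma leq_card_symdiff x y : #|symdiff x y| <= #|x| + #|y|.
Proof.
apply: leq_trans (leq_card_setU _ _) _.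
by apply: leq_add; apply: subset_leq_card; apply: subsetDl.
Qed.

Lemma card_setC_ord x : #|~: x| = n - #|x|.
Proof. by rewrite cardsCs setCK card_ord. Qed.

Lemma antichain_setC A : antichain A -> antichain [set ~: x | x in A].
Proof.
move=> hA _ _ /imsetP[x xA ->] /imsetP[y yA ->] xy.
by rewrite setCS; apply: hA => //; apply: contraNneq xy => ->.
Qed.

Lemma distance_code_setC d A :
  distance_code d A -> distance_code d [set ~: x | x in A].
Proof.
move=> hA _ _ /imsetP[x xA ->] /imsetP[y yA ->] xy.
by rewrite symdiff_setC; apply: hA => //; apply: contraNneq xy => ->.
Qed.

(** Two sets with fewer than [r] elements are at distance below [2 * r]. *)
Lemma card_small_le1 r A :
  distance_code (2 * r + 1) A -> #|[set x in A | #|x| < r]| <= 1.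
Proof.
move=> hA; apply/card_le1_eqP => x y; rewrite !inE.
case/andP=> xA xr /andP[yA yr]; apply/eqP; apply: contraT => xy.
have := leq_trans (hA _ _ yA xA xy) (leq_card_symdiff y x); lia.
Qed.

(* Swapping [V] for [W] cannot land in both the up-closure and the
   down-closure of [A]: by the antichain property it would land on an element
   of [A], at distance [2 * r] from [x]. *)
Lemma exits_cover r A x : 0 < r -> antichain A -> distance_code (2 * r + 1) A ->
  x \in A ->
  'C(#|x|, r) * 'C(n - #|x|, r)
    <= #|exits r A x| + #|exits r [set ~: x | x in A] (~: x)|.
Proof.
move=> r0 hA hd xA.
(* At [~: x] it is [W] that is removed and [V] that is inserted, so pairs are exchanged before the
   two kinds of exits are compared. *)
pose swap (p : {set 'I_n} * {set 'I_n}) := (p.2, p.1).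
have swapK : involutive swap by case.
rewrite -[#|exits r _ (~: x)|](card_imset _ (inv_inj swapK)).
apply: leq_trans (leq_card_setU _ _).
have -> : 'C(#|x|, r) * 'C(n - #|x|, r) = #|setX (draws r x) (draws r (~: x))|.
  by rewrite cardsX !cards_draws card_setC_ord.
apply/subset_leq_card/subsetP => -[V W] /setXP[].
rewrite 2!in_set => /andP[Vx /eqP cV] /andP[Wx /eqP cW].
rewrite in_setU in_exits Vx Wx cV cW !eqxx /=.
set z := _ :|: _; case: (boolP (z \in upset A)) => //=.
rewrite in_set => /existsP[y /andP[yA yz]].
apply/imsetP; exists (W, V) => //; rewrite in_exits setCK Vx Wx cV cW !eqxx /=.
set z' := _ :|: _; apply/negP => /upset_setC [y' y'A].
have -> : ~: z' = z.
  apply/setP => i; rewrite !inE; move/subsetP: Vx => /(_ i).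
  move/subsetP: Wx => /(_ i); rewrite inE.
  case: (i \in x); case: (i \in V); case: (i \in W) => // h1 h2;
    by [have := h1 isT | have := h2 isT].
move=> zy'.
have yy' : y = y'.
  apply/eqP; apply: contraT => /(hA _ _ yA y'A).
  by rewrite (subset_trans yz zy').
have zA : z = y by apply/eqP; rewrite eqEsubset yz andbT yy'.
have dV : symdiff x z = V :|: W.
  apply/setP => i; rewrite !inE; move/subsetP: Vx => /(_ i).
  move/subsetP: Wx => /(_ i); rewrite inE.
  case: (i \in x); case: (i \in V); case: (i \in W) => // h1 h2;
    by [have := h1 isT | have := h2 isT].
(* Since [r] is positive, [V] is nonempty and the swap really moves [x]. *)
have xz : x != z.
  apply/eqP => xz; have : V :|: W = set0 by rewrite -dV -xz /symdiff setDv setU0.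
  by move/eqP; rewrite setU_eq0 -cards_eq0 cV; case: (r) r0.
have := hd _ _ xA _ xz; rewrite zA => /(_ yA); rewrite -zA dV.
have := leq_of_leqif (leq_card_setU V W); rewrite cV cW; lia.
Qed.

Lemma card_dep_pair (T1 T2 : finType) (S : {set T1}) (F : T1 -> {set T2}) :
  #|[set p : T1 * T2 | (p.1 \in S) && (p.2 \in F p.1)]| = \sum_(a in S) #|F a|.
Proof.
rewrite -sum1_card (eq_bigr (fun a => \sum_(b in F a) 1)); last first.
  by move=> a _; rewrite sum1_card.
by rewrite pair_big_dep; apply: eq_bigl => p; rewrite inE.
Qed.

Definition layer A k : {set {set 'I_n}} := [set x in A | #|x| == k].

(* Pairs (x, (V, W)) in [exits] inject into pairs (x ∪ W, V): the
   [r]-neighbourhoods of the code words are disjoint. They miss the pairs coming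
   from elements of the up-closure in the lower layer. *)
Lemma exits_layer r A i : distance_code (2 * r + 1) A ->
  \sum_(x in layer A i) #|exits r A x| + #|layer (upset A) i| * 'C(n - i, r)
    <= #|layer (upset A) (i + r)| * 'C(i + r, r).
Proof.
move=> hd.
pose T1 := [set p : {set 'I_n} * ({set 'I_n} * {set 'I_n}) |
  (p.1 \in layer A i) && (p.2 \in exits r A p.1)].
pose T2 := [set p : {set 'I_n} * {set 'I_n} |
  (p.1 \in layer (upset A) i) && (p.2 \in draws r (~: p.1))].
pose T3 := [set p : {set 'I_n} * {set 'I_n} |
  (p.1 \in layer (upset A) (i + r)) && (p.2 \in draws r p.1)].
pose f1 (p : {set 'I_n} * ({set 'I_n} * {set 'I_n})) := (p.1 :|: p.2.2, p.2.1).
pose f2 (p : {set 'I_n} * {set 'I_n}) := (p.1 :|: p.2, p.2).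
have c1 : \sum_(x in layer A i) #|exits r A x| = #|T1| by rewrite card_dep_pair.
have c2 : #|layer (upset A) i| * 'C(n - i, r) = #|T2|.
  rewrite (card_dep_pair _ (fun z => draws r (~: z))) -sum_nat_const; apply: eq_bigr => z.
  by rewrite inE => /andP[_ /eqP cz]; rewrite cards_draws card_setC_ord cz.
have c3 : #|layer (upset A) (i + r)| * 'C(i + r, r) = #|T3|.
  rewrite (card_dep_pair _ (draws r)) -sum_nat_const; apply: eq_bigr => z.
  by rewrite inE => /andP[_ /eqP cz]; rewrite cards_draws cz.
have disjC x W : W \subset ~: x -> [disjoint x & W].
  by rewrite -disjoints_subset disjoint_sym.
have T1P x V W : (x, (V, W)) \in T1 ->
    [/\ x \in A, #|x| = i, V \subset x, #|V| = r & W \subset ~: x] /\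
    #|W| = r /\ (x :\: V) :|: W \notin upset A.
  rewrite in_set /= [x \in _]in_set => /andP[/andP[xA /eqP cx]].
  rewrite in_exits => /and5P[Vx /eqP cV Wx /eqP cW h].
  by split.
have T2P z V : (z, V) \in T2 ->
    [/\ z \in upset A, #|z| = i, V \subset ~: z & #|V| = r].
  rewrite in_set /= [z \in _]in_set [V \in _]in_set.
  move=> /andP[/andP[zA /eqP cz]] /andP[Vz /eqP cV].
  by split.
have inj1 : {in T1 &, injective f1}.
  move=> [x [V W]] [x' [V' W']] /T1P [[xA _ _ _ Wx] [cW _]] /T1P [[x'A _ _ _ Wx'] [cW' _]].
  case=> e <-.
  have xx' : x = x'.
    (* Equal images confine [symdiff x x'] to [W :|: W'], which has at most [2 * r] elements. *)
    apply/eqP; apply: contraT => /(hd _ _ xA x'A).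
    have : symdiff x x' \subset W :|: W'.
      apply/subsetP => j; move/setP: e => /(_ j); rewrite !inE.
      by case: (j \in x); case: (j \in x'); case: (j \in W); case: (j \in W').
    move/subset_leq_card => h1; have := leq_of_leqif (leq_card_setU W W'); lia.
  rewrite -xx' in e Wx' *; congr (_, (_, _)).
  have dW U : U \subset ~: x -> U = (x :|: U) :\: x.
    by move=> /disjC d; rewrite setDUl setDv set0U; apply/esym/setDidPl; rewrite disjoint_sym.
  by rewrite (dW W) // (dW W') // e.
have inj2 : {in T2 &, injective f2}.
  move=> [z V] [z' V'] /T2P[_ _ Vz _] /T2P[_ _ Vz' _] [e eV].
  rewrite -eV in e Vz' *; congr (_, _).
  have dz U : V \subset ~: U -> U = (U :|: V) :\: V.
    by move=> /disjC d; rewrite setDUl setDv setU0; apply/esym/setDidPl.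
  by rewrite (dz z) // (dz z') // e.
rewrite c1 c2 c3 -(card_in_imset inj1) -(card_in_imset inj2).
(* The two images are disjoint: if [x :|: W = z :|: V] with [V] off [z], then removing [V] gives
   [z = (x :\: V) :|: W], which lies outside the up-closure although [z] lies in it. *)
rewrite -cardsUI [X in _ + X](_ : _ = 0) ?addn0; last first.
  apply/eqP; rewrite cards_eq0 -subset0; apply/subsetP => p; rewrite in_setI.
  case/andP=> /imsetP[[x [V W]] /T1P [[xA _ Vx _ Wx] [_ hU]] ->].
  case/imsetP=> [[z V'] /T2P[zU _ V'z _]] [e eV].
  rewrite -eV in e V'z; case/negP: hU.
  suff -> : x :\: V :|: W = z by [].
  apply/setP => j; move/setP: e => /(_ j); rewrite !inE.
  move/subsetP: V'z => /(_ j); move/subsetP: Wx => /(_ j); rewrite !inE.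
  move/subsetP: Vx => /(_ j).
  case: (j \in x); case: (j \in V); case: (j \in W); case: (j \in z) => // h1 h2 h3 h4;
  by [have := h1 isT | have := h2 isT | have := h3 isT].
apply/subset_leq_card/subsetP => p; rewrite in_setU => /orP[] /imsetP.
  case=> -[x [V W]] /T1P [[xA cx Vx cV Wx] [cW _]] ->.
  rewrite !inE /= cV eqxx andbT (subset_trans Vx (subsetUl _ _)) andbT.
  rewrite cardsU (disjoint_setI0 (disjC _ _ Wx)) cards0 subn0 cx cW eqxx andbT.
  by have := mem_upset xA (subsetUl x W); rewrite inE.
case=> -[z V] /T2P[zU cz Vz cV] ->.
rewrite !inE /= cV eqxx subsetUr !andbT.
rewrite cardsU (disjoint_setI0 (disjC _ _ Vz)) cards0 subn0 cz cV eqxx andbT.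
by have := upset_superset zU (subsetUl z V); rewrite inE.
Qed.

Lemma card_layer_le A k : #|layer A k| <= 'C(n, k).
Proof.
rewrite -[in 'C(n, k)](card_ord n) -cardsT -cards_draws.
by apply/subset_leq_card/subsetP => x; rewrite !inE subsetT => /andP[].
Qed.

End SwapCounting.

(** * Layer densities and a weighted inequality of Lubell type *)

Section LubellInequality.
Import Order.TTheory GRing.Theory Num.Theory.
Local Open Scope ring_scope.

(** Telescoping with gap [r]: only [r] differences survive, however large [m] is. *)
Lemma sumr_shift (u : nat -> rat) r m :
  \sum_(i < m) (u (i + r)%N - u i) = \sum_(j < r) (u (m + j)%N - u j).
Proof.
elim: m => [|m IH].
  by rewrite big_ord0 big1 // => j _; rewrite subrr.
rewrite big_ord_recr /= IH.
have -> : \sum_(j < r) (u (m.+1 + j)%N - u j)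
    = \sum_(j < r) (u (m + j)%N - u j)
      + \sum_(j < r) (u (m + j.+1)%N - u (m + j)%N).
  by rewrite -big_split; apply: eq_bigr => j _ /=; rewrite addSnnS; lra.
rewrite -(big_mkord xpredT (fun j => u (m + j.+1)%N - u (m + j)%N)).
by rewrite (telescope_sumr (fun j => u (m + j)%N)) // addn0.
Qed.

Variable n : nat.
Implicit Types (x y : {set 'I_n}) (A : {set {set 'I_n}}).

(** Since [C(n, i) C(n-i, r) = C(n, i+r) C(i+r, i)], dividing [exits_layer] by this number bounds
    the weight of layer [i] by the density difference [u (i + r) - u i]. The sum telescopes to [r]
    differences of numbers in [[0, 1]]. *)
Lemma exits_lubell r A : (r <= n)%N -> distance_code (2 * r + 1) A ->
  \sum_(x in A | (#|x| <= n - r)%N)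
     #|exits r A x|%:R / ('C(n, #|x|) * 'C(n - #|x|, r))%:R <= r%:R :> rat.
Proof.
move=> rn hd.
pose u i : rat := #|layer (upset A) i|%:R / 'C(n, i)%:R.
have u_ge0 i : 0 <= u i by rewrite divr_ge0 ?ler0n.
have u_le1 i : u i <= 1.
  (* Above [n] the binomial is 0, and division by zero yields 0. *)
  have [in_|ni] := leqP i n; last by rewrite /u bin_small // invr0 mulr0 ler01.
  rewrite ler_pdivrMr ?mul1r ?ler_nat ?card_layer_le //.
  by rewrite ltr0n bin_gt0.
rewrite (partition_big (fun x => inord #|x| : 'I_(n - r).+1) xpredT) //=.
apply: (@le_trans _ _ (\sum_(i < (n - r).+1) (u (i + r)%N - u i))); last first.
  rewrite sumr_shift; apply: (@le_trans _ _ (\sum_(j < r) 1)).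
    by apply: ler_sum => j _; have := u_le1 ((n - r).+1 + j)%N; have := u_ge0 j; lra.
  by rewrite sumr_const card_ord.
apply: ler_sum => i _; have iln : (i <= n - r)%N by have := ltn_ord i; lia.
set c : rat := ('C(n, i) * 'C(n - i, r))%:R.
have c0 : 0 < c by rewrite ltr0n muln_gt0 !bin_gt0; lia.
rewrite (eq_big (fun x => x \in layer A i) (fun x => #|exits r A x|%:R / c)).
- rewrite -mulr_suml -natr_sum ler_pdivrMr // mulrBl lerBrDr.
  have := exits_layer i hd; rewrite -(ler_nat rat) natrD !natrM.
  have ->: u i * c = #|layer (upset A) i|%:R * 'C(n - i, r)%:R.
    by rewrite /u /c natrM mulrA divfK // pnatr_eq0 -lt0n bin_gt0; lia.
  suff ->: u (i + r)%N * c = #|layer (upset A) (i + r)%N|%:R * 'C((i + r)%N, r)%:R by [].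
  rewrite /u /c -mul_bin_add -['C(i + r, i)]bin_sub ?leq_addr // addKn natrM mulrA divfK //.
  by rewrite pnatr_eq0 -lt0n bin_gt0; lia.
- move=> x; rewrite !inE -andbA; congr (_ && _).
  apply/andP/eqP => [[xl /eqP <-]|cx]; first by rewrite inordK.
  by rewrite cx; split=> //; apply/eqP/val_inj; rewrite /= inordK // ltnS.
- move=> x /andP[/andP[_ xl] /eqP ei]; by rewrite /c -ei inordK.
Qed.

(** Summing [key] over the middle sets uses the Lubell bound twice, for [A] and for its complements;
    hence the factor [2 * r]. *)
Lemma card_antichain_code_mid r A (P Q : nat) : (0 < r <= n)%N ->
  antichain A -> distance_code (2 * r + 1) A ->
  (forall i, (r <= i <= n)%N -> ('C(n, i) * Q <= P * 'C(i, r))%N) ->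
  (#|[set x in A | r <= #|x| & #|x| <= n - r]| * Q <= 2 * r * P)%N.
Proof.
move=> /andP[r0 rn] hA hd hPQ.
pose e x : rat := #|exits r A x|%:R.
pose e' x : rat := #|exits r [set ~: x | x in A] (~: x)|%:R.
have h1 := exits_lubell rn hd.
(* The bound for the complements, reindexed so that its sum also runs over [A]. *)
have := exits_lubell rn (distance_code_setC hd).
rewrite big_mkcondr big_imset /=; last by move=> x y _ _; apply: setC_inj.
rewrite -big_mkcondr => h2.
set M := [set x in A | _ & _].
have small (D : pred {set 'I_n}) (F : {set 'I_n} -> rat) :
    (forall x, 0 <= F x) -> {subset M <= D} ->
    \sum_(x in M) F x <= \sum_(x | D x) F x.
  move=> F0 MD; rewrite [leRHS](bigID (mem M)) /=.
  have -> : \sum_(x in M) F x = \sum_(x | D x && (x \in M)) F x.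
    by apply: eq_bigl => x; case: (boolP (x \in M)) => [/MD xD|_]; rewrite ?andbF // andbT.
  by rewrite lerDl sumr_ge0.
rewrite -(ler_nat rat) !natrM.
have key x : x \in M -> Q%:R <= P%:R *
   (e x / ('C(n, #|x|) * 'C(n - #|x|, r))%:R
    + e' x / ('C(n, #|~: x|) * 'C(n - #|~: x|, r))%:R) :> rat.
  rewrite inE => /and3P[xA rx xr].
  have xn : (#|x| <= n)%N by exact: leq_trans xr (leq_subr _ _).
  rewrite card_setC_ord bin_sub // subKn //.
  have cov := exits_cover r0 hA hd xA.
  have b1 : ('C(n, #|x|) * Q <= P * 'C(#|x|, r))%N by apply: hPQ; rewrite rx.
  have b2 : ('C(n, #|x|) * Q <= P * 'C(n - #|x|, r))%N.
    by rewrite -(bin_sub xn); apply: hPQ; rewrite leq_subr andbT leq_subCr.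
  have : 0 < 'C(n, #|x|)%:R :> rat by rewrite ltr0n bin_gt0.
  have : 0 < 'C(#|x|, r)%:R :> rat by rewrite ltr0n bin_gt0.
  have : 0 < 'C(n - #|x|, r)%:R :> rat by rewrite ltr0n bin_gt0 leq_subCr.
  move: cov b1 b2; rewrite -(ler_nat rat) natrD -/(e x) -/(e' x).
  have : 0 <= e x by rewrite ler0n.
  have : 0 <= e' x by rewrite ler0n.
  rewrite -!(ler_nat rat) !natrM.
  move: (e x) (e' x) => a a'.
  move: ('C(n, #|x|)%:R : rat) ('C(#|x|, r)%:R : rat) ('C(n - #|x|, r)%:R : rat).
  move=> N s t a'0 a0 cov b1 b2 t0 s0 N0.
  rewrite mulrDr.
  (* By [cov], [a + a'] is at least [s * t]. Then [b1] trades [Q / s] for [P / N] in the term with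
     [a], and [b2] trades [Q / t] for [P / N] in the term with [a']. *)
  apply: (@le_trans _ _ (Q%:R * (a + a') / (s * t))).
    by rewrite ler_pdivlMr ?mulr_gt0 // ler_wpM2l ?ler0n.
  rewrite mulrDr mulrDl; apply: lerD.
    rewrite mulrA ler_pdivrMr ?mulr_gt0 // mulrAC ler_pdivlMr ?mulr_gt0 //.
    have := ler_wpM2r (mulr_ge0 a0 (ltW t0)) b1; lra.
  rewrite mulrA ler_pdivrMr ?mulr_gt0 // mulrAC ler_pdivlMr ?mulr_gt0 //.
  have := ler_wpM2r (mulr_ge0 a'0 (ltW s0)) b2; lra.
rewrite [leLHS]mulr_natl -sumr_const.
apply: (@le_trans _ _ (\sum_(x in M) P%:R *
   (e x / ('C(n, #|x|) * 'C(n - #|x|, r))%:R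
    + e' x / ('C(n, #|~: x|) * 'C(n - #|~: x|, r))%:R))).
  by apply: ler_sum.
rewrite -mulr_sumr mulrC ler_wpM2r ?ler0n // big_split /=.
rewrite mulr_natl mulr2n; apply: lerD.
  apply: le_trans h1; apply: small => [x|x]; first by rewrite divr_ge0 ?ler0n.
  by rewrite inE /in_mem /= => /and3P[-> _ ->].
apply: le_trans h2; apply: small => [x|x]; first by rewrite divr_ge0 ?ler0n.
rewrite inE => /and3P[xA rx _]; rewrite /in_mem /= card_setC_ord.
apply/andP; split; first exact: xA.
by rewrite leq_sub2l.
Qed.

End LubellInequality.

(** * The integer form of the bound, with an explicit constant *)

Definition antichain_code_const r : nat :=
  (2 * r * (r`! * (2 * r) ^ r * 2 ^ r) + 2 * (r.+1`! * 2 ^ r.+1))%N.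

(** The two summands of the constant pay for the sets of size between [r] and [n - r], and for the
    at most two remaining sets. *)
Lemma card_antichain_code (n r s : nat) (A : {set {set 'I_n}}) :
  (0 < r)%N -> (s ^ 2 <= n)%N -> antichain A -> distance_code (2 * r + 1) A ->
  (#|A| * (n ^ r * s) <= antichain_code_const r * 2 ^ n)%N.
Proof.
move=> r0 hs hA hd; rewrite /antichain_code_const mulnDl.
set P := (r`! * (2 * r) ^ r * 2 ^ (n + r))%N.
set lo := [set x in A | (#|x| < r)%N].
set hi := [set x in A | (#|~: x| < r)%N].
set mid := [set x in A | (r <= #|x|)%N & (#|x| <= n - r)%N].
have lo1 : (#|lo| <= 1)%N by apply: card_small_le1.
have hi1 : (#|hi| <= 1)%N.
  rewrite -(card_imset _ (@setC_inj _)).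
  apply: leq_trans (card_small_le1 (distance_code_setC hd)).
  apply/subset_leq_card/subsetP => _ /imsetP[x + ->].
  by rewrite 2!inE => /andP[xA ->]; rewrite andbT imset_f.
have cover : (#|A| <= #|mid| + (#|lo| + #|hi|))%N.
  apply: (@leq_trans #|mid :|: (lo :|: hi)|).
    apply/subset_leq_card/subsetP => x xA; rewrite !inE xA /= card_setC_ord.
    have : (#|x| <= n)%N by rewrite -[leqRHS](card_ord n) max_card.
    move: #|x| => k kn; lia.
  apply: leq_trans (leq_card_setU _ _) _.
  by rewrite leq_add2l leq_card_setU.
(* Here [s <= n], so [n ^ r * s] is at most [n ^ r.+1]. *)
have tail : (n ^ r * s <= r.+1`! * 2 ^ r.+1 * 2 ^ n)%N.
  rewrite -mulnA -expnD (addnC r.+1).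
  apply: leq_trans (leq_expn_fact_exp2 n r); rewrite expnSr leq_mul2l.
  by apply/orP; right; nia.
have midP : (#|mid| * (n ^ r * s) <= 2 * r * P)%N.
  have [rn|nr] := leqP r n.
    apply: card_antichain_code_mid => //; first by rewrite r0.
    by move=> i /andP[ri _]; apply: bin_ratio_bound.
  (* For [n < r] the truncated [n - r] is 0, so no size is at least [r] and at most [n - r]. *)
  rewrite (_ : mid = set0) ?cards0 //; apply/setP => x; rewrite !inE.
  by apply/negP => /and3P[_ rx xr]; move: (leq_trans rx xr); lia.
apply: leq_trans (leq_mul cover (leqnn _)) _; rewrite mulnDl.
apply: leq_add; first by apply: leq_trans midP _; rewrite /P expnD; lia.
rewrite -[(2 * _ * _)%N]mulnA; apply: leq_mul tail; lia.
Qed.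

(** * Passage to real numbers *)

Open Scope R_scope.

Lemma INR_expn m k : INR (expn m k) = INR m ^ k.
Proof. by elim: k => [//|k IH]; rewrite expnS mult_INR IH. Qed.

Lemma Rpower_opp_half (x : R) (r : nat) : 0 < x ->
  Rpower x (- (INR r + / 2)) = / (x ^ r * sqrt x).
Proof.
by move=> x0; rewrite Rpower_Ropp Rpower_plus Rpower_pow // Rpower_sqrt.
Qed.

Theorem theorem1 :
  forall r : nat, (1 <= r)%nat ->
  exists C : R, 0 < C /\
    forall (n : nat) (A : {set {set 'I_n}}), (1 <= n)%nat ->
      antichain A -> distance_code (2 * r + 1) A ->
      INR #|A| <= C * (2 ^ n) * Rpower (INR n) (- (INR r + / 2)).
Proof.
(* The factor 2 pays for replacing the square root of [n] by its integer part. *)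
move=> r r0; exists (2 * INR (antichain_code_const r)); split.
  apply: Rmult_lt_0_compat; first exact: Rlt_0_2.
  apply: lt_0_INR; apply/ltP.
  by rewrite addn_gt0 !muln_gt0 fact_gt0 !expn_gt0 orbT.
move=> n A n0 hA hd.
have npos : 0 < INR n by apply: lt_0_INR; apply/ltP.
set s := Nat.sqrt n.
have [sle slt] := Nat.sqrt_spec n (Nat.le_0_l n).
have sn : (s ^ 2 <= n)%N by rewrite -mulnn; apply/leP.
have bound := card_antichain_code r0 sn hA hd.
have {bound} : INR #|A| * (INR n ^ r * INR s) <= INR (antichain_code_const r) * 2 ^ n.
  by rewrite -[2]/(INR 2) -!INR_expn -!mult_INR; apply: le_INR; apply/leP.
(* From [1 <= s] follows [n < (s + 1)^2 <= (2 s)^2]. *)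
have sqrt_le : sqrt (INR n) <= 2 * INR s.
  have s_ge1 : (1 <= s)%N by rewrite lt0n; apply/eqP => s0; rewrite -/s s0 in slt; lia.
  rewrite -(sqrt_Rsqr (2 * INR s)).
    apply: sqrt_le_1_alt; rewrite /Rsqr -[2]/(INR 2) -!mult_INR; apply: le_INR.
    rewrite -/s in slt; nia.
  by apply: Rmult_le_pos; [apply: Rlt_le; apply: Rlt_0_2 | apply: pos_INR].
rewrite Rpower_opp_half //.
have pw : 0 < INR n ^ r by apply: pow_lt.
have sq : 0 < sqrt (INR n) by apply: sqrt_lt_R0.
move=> h; apply: (Rmult_le_reg_r (INR n ^ r * sqrt (INR n))).
  exact: Rmult_lt_0_compat.
rewrite Rmult_assoc Rinv_l ?Rmult_1_r; last first.
  by apply: Rgt_not_eq; apply: Rmult_lt_0_compat.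
apply: (Rle_trans _ (2 * (INR #|A| * (INR n ^ r * INR s)))); last first.
  by rewrite Rmult_assoc; apply: Rmult_le_compat_l h; apply: Rlt_le; apply: Rlt_0_2.
have -> : 2 * (INR #|A| * (INR n ^ r * INR s))
  = INR #|A| * (INR n ^ r * (2 * INR s)) by ring.
apply: Rmult_le_compat_l; first exact: pos_INR.
by apply: Rmult_le_compat_l sqrt_le; apply: Rlt_le.
Qed.
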